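(* Let $T>0$ and let $X(\cdot,t)$, $t\in[0,T]$, be a second-order stochastic process (i.e. $E[X(\cdot,t)^2]<+\infty$ for all $t$) for which the mean-square integral $\int_0^TX(t)\,dt$ exists. For each $n$ let $\triangle_n$ be the equal partition $t_j=jT/n$, $j=0,\dots,n$, of $[0,T]$, let $J=\{0,\dots,n-1\}$, let $J_{K(n)}\subset J$ be any subset with exactly $K(n)$ elements, where $K(n)$ is a positive integer with $0<K(n)<n$ and $\lim_{n\to+\infty}K(n)/n=0$, and let $u_j\in[t_j,t_{j+1}]$ be arbitrary. Then $$\mathop{\mathrm{l.i.m.}}_{\|\triangle_n\|\to0}\ \sum_{j\in J\setminus J_{K(n)}}X(u_j)(t_{j+1}-t_j)=\int_0^TX(t)\,dt .$$
   Context: $(\Omega,\mathcal F,P)$ is a probability space and $X(t)=X(\cdot,t)$. $\mathrm{l.i.m.}$ denotes limit in mean square, i.e. in $L^2(\Omega,P)$; $\|\triangle_n\|=\max_{0\le i\le n-1}(t_{i+1}-t_i)$, which is $T/n$ for the equal partition, so $\|\triangle_n\|\to0$ means $n\to\infty$. The mean-square integral of a second-order process is $\int_0^TX(t)\,dt=\mathop{\mathrm{l.i.m.}}_{\|\triangle_n\|\to0}\sum_{i=0}^{n-1}X(u_i)(t_{i+1}-t_i)$; it exists if this limit exists for arbitrary partitions $0=t_0<\cdots<t_n=T$ and arbitrary points $u_i\in[t_i,t_{i+1}]$. *)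

(* Defs.v *)
From HB Require Import structures.
From mathcomp Require Import all_boot all_order all_algebra.
From mathcomp Require Import all_classical all_reals all_analysis.
Set Implicit Arguments.
Unset Strict Implicit.
Unset Printing Implicit Defensive.
Import Order.TTheory GRing.Theory Num.Theory.
Import numFieldNormedType.Exports.
Local Open Scope classical_set_scope.
Local Open Scope ring_scope.

Definition second_order d (Omega : measurableType d) (R : realType)
    (P : probability Omega R) (Y : {RV P >-> R}) : Prop :=
  ('E_P[((Y : Omega -> R) ^+ 2)%R] < +oo)%E.

(* Convergence in L^2(P), along an arbitrary filter on the index type, to an
   element of L^2(P). *)
Definition ms_lim d (Omega : measurableType d) (R : realType)
    (P : probability Omega R) (I : Type) (F : set_system I)
    (Y : I -> Omega -> R) (Z : {RV P >-> R}) : Prop :=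
  second_order Z /\
  ('E_P[((Y i \- (Z : Omega -> R)) ^+ 2)%R])%E @[i --> F] --> 0%E.

(* As for [itv_partition], the partition 0 = t_0 < t_1 < ... < t_n = T is
   represented by the sequence [s] of t_1, ..., t_n, so that n = size s. *)
Definition part_pt (R : realType) (s : seq R) (i : nat) : R :=
  nth 0 (0 :: s) i.

Definition mesh (R : realType) (s : seq R) : R :=
  \big[Num.max/0]_(i < size s) (part_pt s i.+1 - part_pt s i).

(* Only the values of the tag function below [size p.1] are relevant. *)
Definition tagged_partition (R : realType) (T : R) (p : seq R * (nat -> R)) :
    Prop :=
  itv_partition 0 T p.1 /\
  forall i, (i < size p.1)%N ->
    part_pt p.1 i <= p.2 i <= part_pt p.1 i.+1.

(* The filter of "mesh tending to 0", over all partitions of [0, T] and all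
   choices of tags. *)
Definition mesh_to0 (R : realType) (T : R) : set_system (seq R * (nat -> R)) :=
  filter_from [set e : R | 0 < e]
    (fun e => [set p | tagged_partition T p /\ mesh p.1 < e]).

Definition riemann_sum d (Omega : measurableType d) (R : realType)
    (P : probability Omega R) (X : R -> {RV P >-> R})
    (p : seq R * (nat -> R)) (w : Omega) : R :=
  \sum_(i < size p.1) X (p.2 i) w * (part_pt p.1 i.+1 - part_pt p.1 i).

(* The mean-square integral is determined only up to a.s. equality, hence a
   relation: the integral of X over [0, T] exists and equals Z. *)
Definition is_ms_integral d (Omega : measurableType d) (R : realType)
    (P : probability Omega R) (X : R -> {RV P >-> R}) (T : R)
    (Z : {RV P >-> R}) : Prop :=
  ms_lim (mesh_to0 T) (riemann_sum X) Z.

Definition equal_pt (R : realType) (T : R) (n j : nat) : R :=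
  j%:R * T / n%:R.

(* Main.v *)
(* A process that is mean-square integrable on [0, T] is bounded in mean
   square, say by M: moving one tag of a fixed fine equal partition changes the
   Riemann sum by a bounded amount.  Deleting the K(n) terms of J_K(n) from the
   n-th Riemann sum then changes it by at most (T / n) * K(n) * sqrt M in L^2
   norm, which tends to 0. *)
Require Import Defs.
From HB Require Import structures.
From mathcomp Require Import all_boot all_order all_algebra.
From mathcomp Require Import all_classical all_reals all_analysis.
From mathcomp Require Import measurable_realfun.
From mathcomp Require Import ring lra.
Set Implicit Arguments.
Unset Strict Implicit.
Unset Printing Implicit Defensive.
Import Order.TTheory GRing.Theory Num.Theory.
Import numFieldNormedType.Exports.
Local Open Scope classical_set_scope.
Local Open Scope ring_scope.

(** * Second-moment inequalities *)

Lemma sqr_sum_le (R : realType) (I : finType) (A : {set I}) (a : I -> R) :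
  (\sum_(i in A) a i) ^+ 2 <= #|A|%:R * \sum_(i in A) a i ^+ 2.
Proof.
have sumA (x : R) : \sum_(i in A) x = #|A|%:R * x.
  by rewrite sumr_const mulr_natl.
(* The square expands into the products [a i * a j], each at most the mean of the two squares
   because [(a i - a j) ^+ 2] is nonnegative. *)
apply: (@le_trans _ _ (\sum_(i in A) \sum_(j in A) (a i ^+ 2 + a j ^+ 2) / 2)).
  rewrite expr2 big_distrlr /=; apply: ler_sum => i _; apply: ler_sum => j _.
  by have := sqr_ge0 (a i - a j); nra.
under eq_bigr do rewrite -mulr_suml big_split /= sumA.
rewrite -mulr_suml big_split /= -mulr_sumr sumA.
set S := \sum_(i in A) _.
by lra.
Qed.

(** Applies to a bare function and takes extended real values, so sums and differences need no
    finiteness proof; convertible with the expectations inside [second_order] and [ms_lim]. *)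
Definition sqmean d (Omega : measurableType d) (R : realType)
    (P : probability Omega R) (f : Omega -> R) : \bar R := 'E_P[(f ^+ 2)%R]%E.

Section SquareMean.
Context d (Omega : measurableType d) (R : realType) (P : probability Omega R).
Implicit Types f g : Omega -> R.

Lemma measurable_EFin_sqr f :
  measurable_fun setT f -> measurable_fun setT (fun w => (f w ^+ 2)%:E).
Proof. by move=> mf; apply/measurable_EFinP; exact: measurable_funX. Qed.

Lemma sqmeanE f : sqmean P f = (\int[P]_w (f w ^+ 2)%:E)%E.
Proof. by rewrite /sqmean unlock. Qed.

Lemma sqmean_ge0 f : (0 <= sqmean P f)%E.
Proof.
by rewrite sqmeanE; apply: integral_ge0 => w _; rewrite lee_fin sqr_ge0.
Qed.

Lemma sqmeanN f : sqmean P (\- f) = sqmean P f.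
Proof.
by rewrite !sqmeanE; apply: eq_integral => w _ /=; rewrite sqrrN.
Qed.

Lemma sqmeanZ (c : R) f : measurable_fun setT f ->
  sqmean P (fun w => c * f w) = ((c ^+ 2)%:E * sqmean P f)%E.
Proof.
move=> mf; rewrite !sqmeanE -ge0_integralZl_EFin ?sqr_ge0 //=.
- by apply: eq_integral => w _; rewrite exprMn EFinM.
- by move=> w _; rewrite lee_fin sqr_ge0.
- exact: measurable_EFin_sqr.
Qed.

(** Integrates the pointwise bound that follows from [(f w - g w) ^+ 2] being nonnegative. It stands
    in for the triangle inequality in L^2, at the price of a factor 2 but without square roots. *)
Lemma sqmeanD_le f g : measurable_fun setT f -> measurable_fun setT g ->
  (sqmean P (f \+ g)%R <= 2%:E * (sqmean P f + sqmean P g))%E.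
Proof.
move=> mf mg; rewrite !sqmeanE -ge0_integralD //=; first last.
- exact: measurable_EFin_sqr.
- by move=> w _; rewrite lee_fin sqr_ge0.
- exact: measurable_EFin_sqr.
- by move=> w _; rewrite lee_fin sqr_ge0.
have mfg : measurable_fun setT (fun w => (f w ^+ 2)%:E + (g w ^+ 2)%:E)%E.
  by apply: emeasurable_funD; exact: measurable_EFin_sqr.
have fg0 w : (0 <= (f w ^+ 2)%:E + (g w ^+ 2)%:E)%E.
  by rewrite -EFinD lee_fin addr_ge0 ?sqr_ge0.
rewrite -ge0_integralZl_EFin //; apply: ge0_le_integral => //=.
- by move=> w _; rewrite lee_fin sqr_ge0.
- by apply: measurable_EFin_sqr; exact: measurable_funD.
- exact: measurable_funeM.
- move=> w _; rewrite -EFinD -EFinM lee_fin.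
  by have := sqr_ge0 (f w - g w); nra.
Qed.

(** One factor [#|A|] comes from the pointwise Cauchy-Schwarz bound [sqr_sum_le], the other from
    adding up [#|A|] second moments. *)
Lemma sqmean_sum_le (I : finType) (A : {set I}) (f : I -> Omega -> R) (M : R) :
    (forall i, measurable_fun setT (f i)) ->
    (forall i, i \in A -> (sqmean P (f i) <= M%:E)%E) ->
  (sqmean P (fun w => \sum_(i in A) f i w)%R <= (#|A|%:R ^+ 2 * M)%R%:E)%E.
Proof.
move=> mf fM.
have mS : measurable_fun setT (fun w => \sum_(i in A) (f i w ^+ 2)%:E)%E.
  under eq_fun do rewrite big_mkcond /=.
  apply: emeasurable_sum => i; case: (i \in A) => //.
  exact: measurable_EFin_sqr.
apply: (@le_trans _ _
    (\int[P]_w (#|A|%:R%:E * \sum_(i in A) (f i w ^+ 2)%:E))%E).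
  rewrite sqmeanE; apply: ge0_le_integral => //=.
  - by move=> w _; rewrite lee_fin sqr_ge0.
  - apply: measurable_EFin_sqr.
    under eq_fun do rewrite big_mkcond /=.
    by apply: measurable_sum => i; case: (i \in A).
  - exact: measurable_funeM.
  - by move=> w _; rewrite sumEFin -EFinM lee_fin sqr_sum_le.
rewrite ge0_integralZl_EFin //; last first.
  by move=> w _; apply: sume_ge0 => i _; rewrite lee_fin sqr_ge0.
under eq_integral => w _ do rewrite big_mkcond /=.
rewrite ge0_integral_sum //; first last.
- by move=> i w _ /=; case: (i \in A) => //; rewrite lee_fin sqr_ge0.
- by move=> i /=; case: (i \in A) => //; exact: measurable_EFin_sqr.
apply: (@le_trans _ _ (#|A|%:R%:E * \sum_(i in A) M%:E)%E).
  apply: lee_wpmul2l; first by rewrite lee_fin.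
  rewrite [leRHS]big_mkcond /=; apply: lee_sum => i _.
  case: (boolP (i \in A)) => [iA|_]; last by rewrite integral0.
  by rewrite -sqmeanE fM.
by rewrite sumEFin -EFinM sumr_const -[M *+ _]mulr_natl mulrA expr2.
Qed.

End SquareMean.

(** * Equal partitions as tagged partitions of small mesh *)

Definition equal_part (R : realType) (T : R) (n : nat) : seq R :=
  mkseq (fun i => equal_pt T n i.+1) n.

Section EqualPartition.
Context (R : realType) (T : R).
Hypothesis T_gt0 : 0 < T.

Lemma equal_pt_step n j :
  equal_pt T n j.+1 - equal_pt T n j = T / n%:R.
Proof. by rewrite /equal_pt -natr1; ring. Qed.

Lemma equal_ptn n : (0 < n)%N -> equal_pt T n n = T.
Proof.
by move=> n0; rewrite /equal_pt mulrAC divff ?mul1r // pnatr_eq0 -lt0n.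
Qed.

Lemma equal_pt_ge0 n j : 0 <= equal_pt T n j.
Proof. by rewrite /equal_pt divr_ge0 ?mulr_ge0 // ltW. Qed.

Lemma equal_pt_leT n j : (j <= n)%N -> equal_pt T n j <= T.
Proof.
case: n => [|n jn].
  by rewrite leqn0 => /eqP ->; rewrite /equal_pt !mul0r ltW.
by rewrite /equal_pt ler_pdivrMr ?ltr0n // mulrC ler_wpM2l ?ler_nat // ltW.
Qed.

Lemma part_pt_equal n i : (i <= n)%N ->
  part_pt (equal_part T n) i = equal_pt T n i.
Proof.
case: i => [_|i ltin]; first by rewrite /part_pt /equal_pt !mul0r.
by rewrite /part_pt /= nth_mkseq.
Qed.

Lemma equal_part_itv n : (0 < n)%N -> itv_partition 0 T (equal_part T n).
Proof.
move=> n0; split.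
  apply/(pathP 0) => i; rewrite size_mkseq => ltin.
  rewrite -[nth 0 (0 :: _) i]/(part_pt _ i).
  rewrite -[nth 0 _ i]/(part_pt _ i.+1) !part_pt_equal // 1?ltnW //.
  by rewrite -subr_gt0 equal_pt_step divr_gt0 ?ltr0n.
rewrite (last_nth 0) size_mkseq -[nth _ _ _]/(part_pt _ n) part_pt_equal //.
by rewrite equal_ptn.
Qed.

Lemma equal_part_tagged n (v : nat -> R) : (0 < n)%N ->
    (forall i, (i < n)%N -> equal_pt T n i <= v i <= equal_pt T n i.+1) ->
  tagged_partition T (equal_part T n, v).
Proof.
move=> n0 vP; split; first exact: equal_part_itv.
move=> i /=; rewrite size_mkseq => ltin.
by rewrite !part_pt_equal // 1?ltnW // vP.
Qed.

Lemma mesh_equal_part_lt n (e : R) :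
  0 < e -> T / n%:R < e -> mesh (equal_part T n) < e.
Proof.
move=> e0 Tne; apply: bigmax_lt => // -[i]; rewrite size_mkseq => ltin _ /=.
by rewrite !part_pt_equal // 1?ltnW // equal_pt_step.
Qed.

(** Positivity of [n] is recorded because a single such [n] is extracted later, and [T / 0 = 0]
    would pass the second condition. *)
Lemma near_mesh_lt (e : R) : 0 < e ->
  \forall n \near \oo, (0 < n)%N /\ T / n%:R < e.
Proof.
move=> e0; near=> n.
have n0 : (0 < n)%N by near: n; exact: nbhs_infty_gt.
split=> //; rewrite ltr_pdivrMr ?ltr0n // mulrC -ltr_pdivrMr //.
by near: n; exact: nbhs_infty_gtr.
Unshelve. all: by end_near. Qed.

Lemma equal_pt_cover n t : (0 < n)%N -> 0 <= t <= T ->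
  exists2 k, (k < n)%N & equal_pt T n k <= t <= equal_pt T n k.+1.
Proof.
move=> n0 /andP[t0 tT].
(* With [n] fixed, the right end [T] is relaxed to the [m]-th point, so that induction on [m] can
   peel off the last interval. *)
suff H m : (0 < m)%N -> t <= equal_pt T n m ->
    exists2 k, (k < m)%N & equal_pt T n k <= t <= equal_pt T n k.+1.
  by apply: H; rewrite // equal_ptn.
elim: m => [//|[_ _ tm|m ihm _ tm]].
  by exists 0 => //; rewrite tm /equal_pt !mul0r t0.
have [/ihm[//|k ltkm tk]|/ltW mt] := leP t (equal_pt T n m.+1).
  by exists k => //; exact: ltnW.
by exists m.+1 => //; rewrite mt.
Qed.

(** Turns a limit over all tagged partitions into a limit in [n], by composition of filters. *)
Lemma equal_part_filterlim (v : nat -> nat -> R) :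
    (forall n i, (1 < n)%N -> (i < n)%N ->
      equal_pt T n i <= v n i <= equal_pt T n i.+1) ->
  (equal_part T n, v n) @[n --> \oo] --> mesh_to0 T.
Proof.
move=> vP A [e /= e0 Ae].
suff: \forall n \near \oo, A (equal_part T n, v n) by [].
near=> n; apply: Ae; split => /=.
  apply: equal_part_tagged => //; first by near: n; exact: nbhs_infty_gt.
  by move=> i; apply: vP; near: n; exact: nbhs_infty_gt.
apply: mesh_equal_part_lt => //.
suff [] : (0 < n)%N /\ T / n%:R < e by [].
by near: n; exact: near_mesh_lt.
Unshelve. all: by end_near. Qed.

End EqualPartition.

(** * Mean-square boundedness of an integrable process *)

Section MeanSquareIntegral.
Context d (Omega : measurableType d) (R : realType) (P : probability Omega R).
Context (T : R) (X : R -> {RV P >-> R}) (Z : {RV P >-> R}).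
Hypothesis T_gt0 : 0 < T.

Lemma riemann_sum_equal n (v : nat -> R) w :
  riemann_sum X (equal_part T n, v) w = T / n%:R * \sum_(i < n) X (v i) w.
Proof.
rewrite /riemann_sum /= size_mkseq mulr_sumr; apply: eq_bigr => i _.
by rewrite !part_pt_equal // 1?ltnW // equal_pt_step mulrC.
Qed.

Lemma measurable_riemann_sum p : measurable_fun setT (riemann_sum X p).
Proof.
apply: measurable_sum => i.
by apply: measurable_funM => //; exact: measurable_cst.
Qed.

Hypothesis XZ : is_ms_integral X T Z.

(* Two Riemann sums over one equal partition which differ only in the tag of a
   single interval have bounded distance, which bounds X at the moved tag. *)
Lemma ms_integrable_sqmean_bounded :
    (forall t, 0 <= t <= T -> second_order (X t)) ->
  exists M : R, forall t, 0 <= t <= T -> (sqmean P (X t) <= M%:E)%E.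
Proof.
move=> X2.
(* The threshold 1 is arbitrary; what matters is that one [e] serves all choices of tags. *)
have [e e0 Xe] : exists2 e, 0 < e & forall p, tagged_partition T p ->
    mesh p.1 < e -> (sqmean P (riemann_sum X p \- Z)%R < 1)%E.
  have [e e0 Xe] := XZ.2 _ (nbhs_open_ereal_lt (f := fun=> 1 : R) ltr01).
  by exists e => // p pT pe; exact: (Xe p (conj pT pe)).
have [n [n0 Tn]] : exists n, (0 < n)%N /\ T / n%:R < e.
  by have [n _ /(_ n (leqnn n))] := near_mesh_lt T e0; exists n.
have Se v : (forall i, (i < n)%N ->
      equal_pt T n i <= v i <= equal_pt T n i.+1) ->
    (sqmean P (riemann_sum X (equal_part T n, v) \- Z)%R <= 1)%E.
  move=> vP; apply/ltW/Xe; first exact: equal_part_tagged.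
  exact: mesh_equal_part_lt.
have X2t k : (k < n)%N -> sqmean P (X (equal_pt T n k)) \is a fin_num.
  move=> kn; rewrite ge0_fin_numE ?sqmean_ge0 //; apply: X2.
  by rewrite equal_pt_ge0 // equal_pt_leT // ltnW.
(* Since [n] is now fixed, this finite sum bounds the second moments at all left endpoints at
   once. *)
set m := \sum_(k < n) fine (sqmean P (X (equal_pt T n k))).
set h := T / n%:R.
have h0 : 0 < h by rewrite divr_gt0 ?ltr0n.
(* The outer 2 comes from splitting [X t] into [h^-1 * (S - S0)] plus the value at a left endpoint;
   the 4 bounds the second moment of [S - S0]. *)
exists (2 * (h^-1 ^+ 2 * 4 + m)) => t tT.
have [k kn /andP[kt tk]] := equal_pt_cover n0 tT.
(* Left-endpoint tags, except that the tag of the interval containing [t] is moved to [t]. *)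
pose v i := if i == k then t else equal_pt T n i.
have pt_le i : equal_pt T n i <= equal_pt T n i <= equal_pt T n i.+1.
  by rewrite lexx -subr_ge0 equal_pt_step ltW.
pose S := riemann_sum X (equal_part T n, v).
pose S0 := riemann_sum X (equal_part T n, equal_pt T n).
(* All terms but the [k]-th cancel in [S - S0], leaving [h] times the increment of [X] from the left
   endpoint to [t]. *)
have -> : (X t : Omega -> R) =
    (fun w => h^-1 * (S w - S0 w)) \+ X (equal_pt T n k).
  apply/funext => w /=.
  rewrite /S /S0 !riemann_sum_equal -/h -mulrBr mulKf ?gt_eqF //.
  rewrite (bigD1 (Ordinal kn)) //= [in X in _ - X](bigD1 (Ordinal kn)) //=.
  rewrite /v eqxx.
  rewrite [X in _ + X - _](eq_bigr (fun i : 'I_n => X (equal_pt T n i) w)).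
    by ring.
  by move=> i; rewrite -val_eqE /= => /negbTE ->.
have mS : measurable_fun setT S by exact: measurable_riemann_sum.
have mS0 : measurable_fun setT S0 by exact: measurable_riemann_sum.
have mSS : measurable_fun setT (fun w => S w - S0 w) by exact: measurable_funB.
apply: le_trans (sqmeanD_le _ _ _) _ => //.
  by apply: measurable_funM => //; exact: measurable_cst.
rewrite EFinM; apply: lee_wpmul2l; first by rewrite lee_fin.
rewrite EFinD sqmeanZ //; apply: leeD.
  rewrite (EFinM _ 4); apply: lee_wpmul2l; first by rewrite lee_fin sqr_ge0.
  (* Both sums are within 1 of [Z] in second moment, so their difference has second moment at most 2
     * (1 + 1) = 4. *)
  have -> : (fun w => S w - S0 w) = (S \- Z) \+ (\- (S0 \- Z)).
    by apply/funext => w /=; ring.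
  apply: le_trans (sqmeanD_le _ _ _) _ => //.
  - exact: measurable_funB.
  - by apply: measurableT_comp => //; exact: measurable_funB.
  rewrite sqmeanN (_ : 4%:E = 2%:E * (1 + 1))%E; last first.
    by rewrite -EFinD -EFinM; congr EFin; ring.
  apply: lee_wpmul2l => //; apply: leeD; apply: Se => // i _.
  by rewrite /v; case: eqP => // ->; rewrite kt.
rewrite -(fineK (X2t _ kn)) lee_fin /m (bigD1 (Ordinal kn)) //= lerDl.
by apply: sumr_ge0 => i _; rewrite fine_ge0 // sqmean_ge0.
Qed.

End MeanSquareIntegral.


(** * Removal of the deleted terms in the limit *)

Theorem theorem6 (d : measure_display) (Omega : measurableType d)
    (R : realType) (P : probability Omega R) (T : R) (T_gt0 : 0 < T)
    (X : R -> {RV P >-> R})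
    (X_second_order : forall t, 0 <= t <= T -> second_order (X t))
    (intX : {RV P >-> R}) (intXP : is_ms_integral X T intX)
    (K : nat -> nat) (K_bounds : forall n, (1 < n)%N -> (0 < K n < n)%N)
    (K_lim : (K n)%:R / n%:R @[n --> \oo] --> (0 : R))
    (JK : forall n : nat, {set 'I_n})
    (card_JK : forall n, (1 < n)%N -> #|JK n| = K n)
    (u : forall n : nat, 'I_n -> R)
    (u_tag : forall n (j : 'I_n), (1 < n)%N ->
      equal_pt T n j <= u n j <= equal_pt T n j.+1) :
  ms_lim \oo
    (fun n w => \sum_(j in ~: JK n)
       X (u n j) w * (equal_pt T n j.+1 - equal_pt T n j))
    intX.

Proof.
split; first exact: intXP.1.
have [M XM] := ms_integrable_sqmean_bounded T_gt0 intXP X_second_order.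
(* Riemann sums take tags indexed by [nat]; the default 0 is only used at indices from [n] on, which
   the sum never reads. *)
pose v n i := if insub i is Some j then u n j else 0.
have vE n (j : 'I_n) : v n j = u n j by rewrite /v valK.
have vP n i : (1 < n)%N -> (i < n)%N ->
    equal_pt T n i <= v n i <= equal_pt T n i.+1.
  by move=> n1 ltin; have := u_tag n (Ordinal ltin) n1; rewrite -vE.
have Sv : (sqmean P (riemann_sum X (equal_part T n, v n) \- intX)%R)
    @[n --> \oo] --> 0%E.
  exact: cvg_comp (equal_part_filterlim T_gt0 vP) intXP.2.
(* The majorant: error of the full Riemann sum plus the bound on the deleted part, with
   [T / n * K n] regrouped so that [K_lim] applies. *)
pose D (n : nat) : \bar R :=
  (2%:E * (sqmean P (riemann_sum X (equal_part T n, v n) \- intX)%R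
     + ((T * ((K n)%:R / n%:R)) ^+ 2 * M)%R%:E))%E.
apply: (@squeeze_cvge _ _ _ _ (cst 0%E) _ D); first last.
- rewrite -[0%E](mule0 2%:E) -[in X in (_ * X)%E](adde0 0%E).
  apply: cvgeZl => //; apply: cvgeD => //.
  apply: cvg_EFin; first by apply: nearW.
  have -> : 0 = (T * 0) ^+ 2 * M by rewrite mulr0 expr0n mul0r.
  have KT : T * ((K n)%:R / n%:R) @[n --> \oo] --> T * 0.
    by apply: cvgM K_lim; exact: cvg_cst.
  by apply: cvgM (cvgM KT KT) _; exact: cvg_cst.
- exact: cvg_cst.
near=> n.
have n1 : (1 < n)%N by near: n; exact: nbhs_infty_gt.
rewrite sqmean_ge0 /=.
have mJ : measurable_fun setT (fun w => \sum_(j in JK n) X (u n j) w).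
  under eq_fun do rewrite big_mkcond /=.
  by apply: measurable_sum => j; case: (j \in JK n).
(* The truncated sum is the full Riemann sum minus the deleted terms, whose common factor is the
   step [T / n]; the sign disappears on squaring. *)
rewrite -/(sqmean P _) [X in sqmean P X](_ : _ =
    (riemann_sum X (equal_part T n, v n) \- intX)
    \+ (fun w => (- (T / n%:R)) * \sum_(j in JK n) X (u n j) w)); last first.
  apply/funext => w /=.
  have -> : riemann_sum X (equal_part T n, v n) w = T / n%:R *
      (\sum_(j in JK n) X (u n j) w + \sum_(j in ~: JK n) X (u n j) w).
    rewrite riemann_sum_equal (bigID (mem (JK n))) /=; congr (_ * (_ + _)).
      by apply: eq_bigr => j _; rewrite vE.
    by apply: eq_big => j; rewrite ?inE // vE.
  under eq_bigr do rewrite equal_pt_step.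
  by rewrite -mulr_suml; ring.
apply: le_trans (sqmeanD_le _ _ _) _.
- by apply: measurable_funB => //; exact: measurable_riemann_sum.
- by apply: measurable_funM => //; exact: measurable_cst.
apply: lee_wpmul2l => //; apply: leeD => //.
rewrite sqmeanZ //.
(* The tags lie in [0, T], so [M] bounds every deleted term; the squared step times [K n] squared is
   then exactly the second term of [D]. *)
apply: (@le_trans _ _ (((- (T / n%:R)) ^+ 2)%:E * (#|JK n|%:R ^+ 2 * M)%:E)%E).
  apply: lee_wpmul2l; first by rewrite lee_fin sqr_ge0.
  apply: sqmean_sum_le => // j _; apply: XM.
  have /andP[ju uj] := u_tag n j n1.
  by rewrite (le_trans _ ju) ?equal_pt_ge0 // (le_trans uj) // equal_pt_leT.
by rewrite -EFinM lee_fin card_JK // le_eqVlt; apply/orP; left; apply/eqP; ring.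
Unshelve. all: by end_near. Qed.
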